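(* Let $\alpha,\beta$ be left c.e.\ reals. There is a computable number $d$ such that for all $n$ and all $c\in\mathbb{N}$: if $C(\alpha_n)=C(\beta_n)-c-d$, then no program of length at most $C_{\beta,n}-2\log c-d$ transforms $\beta_n$ into $\alpha_n$, i.e.\ $C(\alpha_n\mid\beta_n)>C_{\beta,n}-2\log c-d$.
   Context: $C(x\mid y)$ is plain conditional Kolmogorov complexity with respect to a fixed universal, additively optimal binary Turing machine, and $C(x)=C(x\mid\epsilon)$. A left c.e.\ real is the limit of a computable increasing sequence of rationals; $\alpha_n$ denotes the first $n$ binary digits of $\alpha$. $C_{\beta,n}:=C(C(\beta_n)\mid\beta_n)$. The constant $d$ is computable from the lengths of programs enumerating rational approximations of $\alpha$ and $\beta$ from below. *)

(* Defs.v *)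
From mathcomp Require Import all_boot all_order all_algebra.
From mathcomp Require Import all_classical all_reals all_analysis.
Set Implicit Arguments.
Unset Strict Implicit.
Unset Printing Implicit Defensive.
Import Order.TTheory GRing.Theory Num.Theory.
Import numFieldNormedType.Exports.
Local Open Scope classical_set_scope.
Local Open Scope ring_scope.

(* Kleene's partial recursive functions, by arity. *)
Inductive recfun : nat -> Type :=
| RZero k : recfun k
| RSucc : recfun 1
| RProj k (i : 'I_k) : recfun k
| RComp k m (h : recfun m) (g : 'I_m -> recfun k) : recfun k
| RPrec k (f : recfun k) (g : recfun k.+2) : recfun k.+1
| RMu k (f : recfun k.+1) : recfun k.

(* Graph of the function defined by primitive recursion on its first
   argument; the step receives (counter, previous value, parameters). *)
Fixpoint prec_graph k (F : k.-tuple nat -> nat -> Prop)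
    (G : k.+2.-tuple nat -> nat -> Prop) (n : nat) (v : k.-tuple nat)
    (y : nat) : Prop :=
  match n with
  | 0%N => F v y
  | n'.+1 => exists2 z, prec_graph F G n' v z & G [tuple of n' :: z :: v] y
  end.

(* [reval e v y]: the partial function e is defined at v with value y. *)
Fixpoint reval k (e : recfun k) : k.-tuple nat -> nat -> Prop :=
  match e in recfun k return k.-tuple nat -> nat -> Prop with
  | RZero _ => fun _ y => y = 0%N
  | RSucc => fun v y => y = (thead v).+1
  | RProj _ i => fun v y => y = tnth v i
  | RComp _ m h g => fun v y =>
      exists2 w : m.-tuple nat, (forall i, reval (g i) v (tnth w i))
                              & reval h w y
  | RPrec _ f g => fun v y =>
      prec_graph (reval f) (reval g) (thead v) [tuple of behead v] y
  | RMu _ f => fun v y =>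
      reval f [tuple of y :: v] 0%N /\
      (forall z, (z < y)%N -> exists t, reval f [tuple of z :: v] t.+1)
  end.

Definition computable1 (f : nat -> nat) : Prop :=
  exists e : recfun 1, forall x, reval e [tuple x] (f x).

Definition computable2 (f : nat -> nat -> nat) : Prop :=
  exists e : recfun 2, forall x y, reval e [tuple x; y] (f x y).

(* Binary strings are identified with natural numbers through the
   length-lexicographic bijection: the empty string is 0, then 0, 1, 00, 01,
   10, ... are 1, 2, 3, 4, 5, ... *)
Definition strnum (s : seq bool) : nat :=
  foldl (fun n (b : bool) => (n.*2 + b.+1)%N) 0%N s.

(* A machine is a binary partial recursive function (program, condition);
   [runs M p y x]: on program p and condition y, M halts with output x. *)
Definition runs (M : recfun 2) (p : seq bool) (y x : nat) : Prop :=
  reval M [tuple strnum p; y] x.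

Definition universal (U : recfun 2) : Prop :=
  forall f : recfun 1, exists p : seq bool,
    forall y x, runs U p y x <-> reval f [tuple y] x.

(* C_U(x|y) <= C_V(x|y) + c for every machine V, where C_V(x|y) is infinite
   when no program of V produces x from y. *)
Definition additively_optimal (U : recfun 2) : Prop :=
  forall V : recfun 2, exists c : nat, forall p y x, runs V p y x ->
    exists2 p', runs U p' y x & (size p' <= size p + c)%N.

(* Conditional complexity C(x|y): least length of a program producing x from
   y. The default 0 is used only if there is no such program, which does not
   happen when M is additively optimal. *)
Definition Ccond (M : recfun 2) (x y : nat) : nat :=
  xget 0%N [set k | (exists2 p, size p = k & runs M p y x) /\
                    (forall p, runs M p y x -> (k <= size p)%N)].

(* C(x) = C(x|epsilon); strnum [::] = 0. *)
Definition Cplain (M : recfun 2) (x : nat) : nat := Ccond M x (strnum [::]).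

(* A numbering of the rationals: 2^a 3^b 5^c represents (a - b) / (c + 1). *)
Definition rat_of_code (m : nat) : rat :=
  ((logn 2 m)%:R - (logn 3 m)%:R) / (logn 5 m).+1%:R.

Section Reals.
Variable R : realType.

Definition approx_below (f : nat -> nat) (x : R) : Prop :=
  (forall i j, (i <= j)%N -> rat_of_code (f i) <= rat_of_code (f j)) /\
  (ratr (rat_of_code (f k)) : R) @[k --> \oo] --> x.

Definition left_ce (x : R) : Prop :=
  exists2 f, computable1 f & approx_below f x.

(* The U-program a enumerates rational approximations of x from below. *)
Definition enumerates_below (U : recfun 2) (a : seq bool) (x : R) : Prop :=
  exists2 f, (forall k, runs U a k (f k)) & approx_below f x.

(* The i-th binary digit (from 0) after the binary point; dyadic rationals get
   their expansion ending in zeros. *)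
Definition digit (x : R) (i : nat) : bool :=
  odd `|Num.floor (2 ^+ i.+1 * x)|%N.

(* x_n, the first n binary digits of x (of its fractional part when x is not in
   [0, 1)), as a number. *)
Definition digits (x : R) (n : nat) : nat := strnum (mkseq (digit x) n).

Definition log2 (x : R) : R := ln x / ln 2.

(* C_{x,n} = C(C(x_n) | x_n). *)
Definition CC (U : recfun 2) (x : R) (n : nat) : nat :=
  Ccond U (Cplain U (digits x n)) (digits x n).

(* For c = 0 the term log c is read as 0 (the value of [ln 0]). *)
Definition no_short_transformation (U : recfun 2) (alpha beta : R) (d : nat) :
    Prop :=
  forall n c : nat,
    (Cplain U (digits alpha n))%:Z =
      (Cplain U (digits beta n))%:Z - c%:Z - d%:Z ->
    let bound : R := (CC U beta n)%:R - 2 * log2 c%:R - d%:R in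
    (forall p, (size p)%:R <= bound ->
       ~ runs U p (digits beta n) (digits alpha n)) /\
    bound < (Ccond U (digits alpha n) (digits beta n))%:R.

End Reals.

(* Main.v *)
Require Import Defs.
From mathcomp Require Import all_boot all_order all_algebra.
From mathcomp Require Import all_classical all_reals all_analysis.
From mathcomp Require Import zify ring lra.
Set Implicit Arguments.
Unset Strict Implicit.
Unset Printing Implicit Defensive.
Import Order.TTheory GRing.Theory Num.Theory.
Import numFieldNormedType.Exports.
Local Open Scope classical_set_scope.
Local Open Scope nat_scope.

(** Let q be a shortest program for alpha_n and
    let t be the first stage at which the approximation of beta is within one
    unit in the n-th digit. If q halts after stage t, then q, an enumeration b
    of beta and one extra bit determine beta_n, so C(beta_n) exceeds C(alpha_n)
    by at most 2|b| + O(1), which is excluded for large d. Otherwise, from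
    beta_n and b one finds the stage t, a program p that maps beta_n to alpha_n
    gives alpha_n, and simulating all programs up to stage t gives C(alpha_n)
    and thus C(beta_n) = C(alpha_n) + c + d. Hence C(C(beta_n) | beta_n) is at
    most |p| + 2 log c + 2|b| + m + O(1) when d = 2^m, and m := |b| + K works
    for a large constant K. Approximations may stay strictly below a dyadic
    beta, hence the tolerance of one unit. *)

(** * Total recursive functions of an environment *)

(* An environment [nat -> nat] lists the arguments, padded with zeros; at
   arity k only its first k entries matter. *)
Definition total_rec (F : (nat -> nat) -> nat) : Prop :=
  forall k, exists e : recfun k,
    forall v : k.-tuple nat, reval e v (F (nth 0 v)).

Definition scons (x : nat) (rho : nat -> nat) (i : nat) : nat :=
  if i is j.+1 then rho j else x.

Lemma nth_scons x (v : seq nat) : nth 0 (x :: v) = scons x (nth 0 v).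
Proof. by apply: funext => -[]. Qed.

Lemma total_rec_ext F G : F =1 G -> total_rec F -> total_rec G.
Proof. by move=> /funext ->. Qed.

Lemma total_rec_const n : total_rec (fun _ => n).
Proof.
move=> k; elim: n => [|n [e he]]; first by exists (RZero k).
by exists (RComp RSucc (fun _ => e)) => v /=; exists [tuple n] => // i;
  rewrite (tnth_nth 0) ord1.
Qed.

Lemma total_rec_var i : total_rec (fun rho => rho i).
Proof.
move=> k; case: (ltnP i k) => ik.
  by exists (RProj (Ordinal ik)) => v /=; rewrite (tnth_nth 0).
by exists (RZero k) => v /=; rewrite nth_default // size_tuple.
Qed.

Lemma total_rec_succ F : total_rec F -> total_rec (fun rho => (F rho).+1).
Proof.
move=> hF k; have [e he] := hF k.
exists (RComp RSucc (fun _ => e)) => v /=; exists [tuple F (nth 0 v)] => // i.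
by rewrite (tnth_nth 0) ord1.
Qed.

Lemma total_rec_shift F :
  total_rec F -> total_rec (fun rho => F (fun i => rho i.+1)).
Proof.
move=> hF k; have [e he] := hF k.-1.
have lt_k (i : 'I_k.-1) : i.+1 < k by case: k {e he} i => [|k] [i] //=.
exists (RComp e (fun i => RProj (Ordinal (lt_k i)))) => v /=.
exists [tuple of behead v]; last first.
  have -> : (fun i => nth 0 v i.+1) = nth 0 [tuple of behead v].
    by apply: funext => i /=; rewrite nth_behead.
  exact: he.
by move=> i; rewrite !(tnth_nth 0) /= nth_behead.
Qed.

Lemma total_rec_shift2 F :
  total_rec F -> total_rec (fun rho => F (fun i => rho i.+2)).
Proof. by move=> /total_rec_shift /total_rec_shift. Qed.

Lemma total_rec_scons F N : total_rec F -> total_rec N ->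
  total_rec (fun rho => F (scons (N rho) rho)).
Proof.
move=> hF hN k; have [e he] := hF k.+1; have [n hn] := hN k.
exists (RComp e (fun i => if unlift ord0 i is Some j then RProj j else n)).
move=> v /=; exists [tuple of N (nth 0 v) :: v]; last first.
  by rewrite -nth_scons; apply: he.
move=> i; case: unliftP => [j ->|->] /=; first by rewrite !(tnth_nth 0).
exact: hn.
Qed.

(** [RPrec] hands its step the counter, the accumulator and then the parameters; hence in the body
    the counter is [rho 0], the accumulator [rho 1], and outer variables are shifted by two. *)
Lemma total_rec_iteri (G : nat -> nat -> (nat -> nat) -> nat) N F :
  total_rec N -> total_rec F ->
  total_rec (fun rho => G (rho 0) (rho 1) (fun i => rho i.+2)) ->
  total_rec (fun rho => iteri (N rho) (fun i a => G i a rho) (F rho)).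
Proof.
move=> hN hF hG.
suff h : total_rec (fun rho => iteri (rho 0)
   (fun i a => G i a (fun j => rho j.+1)) (F (fun j => rho j.+1))).
  exact: (total_rec_scons h hN).
(* [RPrec] has no instance at arity 0; there the padded count [rho 0] is 0, so the iteration is just
   [F]. *)
case=> [|k].
  have [e he] := hF 0; exists e => v; rewrite tuple0 /=.
  have -> : (fun j => nth 0 [::] j.+1) = nth 0 [::] by apply: funext => -[].
  exact: (he [tuple]).
have [f hf] := hF k; have [g hg] := hG k.+2.
exists (RPrec f g) => v /=.
case/tupleP: v => n v; rewrite theadE /=.
have -> : [tuple of behead [tuple of n :: v]] = v by apply: val_inj.
elim: n => [|n IHn] /=; first exact: hf.
eexists; first exact: IHn.
exact: (hg [tuple of n :: _ :: v]).
Qed.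

Ltac total_rec_step := first
  [ exact: total_rec_const | exact: total_rec_var | assumption
  | match goal with H : total_rec _ |- _ =>
      first [exact (total_rec_shift2 H)
            | exact (total_rec_shift2 (total_rec_shift2 H)) ] end
  | apply: total_rec_succ | apply: total_rec_iteri ].

Lemma total_rec_addn F G : total_rec F -> total_rec G ->
  total_rec (fun rho => F rho + G rho).
Proof.
move=> hF hG.
apply: (@total_rec_ext (fun rho => iteri (G rho) (fun _ a => a.+1) (F rho))).
  by move=> rho; elim: (G rho) => [|n IHn] /=; rewrite ?IHn; lia.
by do !total_rec_step.
Qed.

Lemma total_rec_predn F : total_rec F -> total_rec (fun rho => (F rho).-1).
Proof.
move=> hF.
apply: (@total_rec_ext (fun rho => iteri (F rho) (fun i _ => i) 0)).
  by move=> rho; case: (F rho).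
by do !total_rec_step.
Qed.

Lemma total_rec_subn F G : total_rec F -> total_rec G ->
  total_rec (fun rho => F rho - G rho).
Proof.
move=> hF hG.
apply: (@total_rec_ext (fun rho => iteri (G rho) (fun _ a => a.-1) (F rho))).
  by move=> rho; elim: (G rho) => [|n IHn] /=; rewrite ?IHn; lia.
by do !(total_rec_step || apply: total_rec_predn).
Qed.

Lemma total_rec_muln F G : total_rec F -> total_rec G ->
  total_rec (fun rho => F rho * G rho).
Proof.
move=> hF hG.
apply: (@total_rec_ext (fun rho => iteri (G rho) (fun _ a => F rho + a) 0)).
  by move=> rho; elim: (G rho) => [|n IHn] /=; rewrite ?IHn; lia.
by do !(total_rec_step || apply: total_rec_addn).
Qed.

Lemma total_rec_expn F G : total_rec F -> total_rec G ->
  total_rec (fun rho => F rho ^ G rho).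
Proof.
move=> hF hG.
apply: (@total_rec_ext (fun rho => iteri (G rho) (fun _ a => F rho * a) 1)).
  by move=> rho; elim: (G rho) => [|n IHn] /=; rewrite ?IHn ?expnS.
by do !(total_rec_step || apply: total_rec_muln).
Qed.

Lemma total_rec_leq F G : total_rec F -> total_rec G ->
  total_rec (fun rho => F rho <= G rho).
Proof.
move=> hF hG.
apply: (@total_rec_ext (fun rho => 1 - (F rho - G rho))).
  by move=> rho; lia.
by do !(total_rec_step || apply: total_rec_subn).
Qed.

Lemma total_rec_eq F G : total_rec F -> total_rec G ->
  total_rec (fun rho => F rho == G rho).
Proof.
move=> hF hG.
apply: (@total_rec_ext (fun rho => (F rho <= G rho) * (G rho <= F rho))).
  by move=> rho; rewrite mulnb -eqn_leq.
by apply: total_rec_muln; apply: total_rec_leq.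
Qed.

Lemma total_rec_maxn F G : total_rec F -> total_rec G ->
  total_rec (fun rho => maxn (F rho) (G rho)).
Proof.
move=> hF hG; apply: (@total_rec_ext (fun rho => F rho + (G rho - F rho))).
  by move=> rho; rewrite maxnE.
by apply: total_rec_addn => //; apply: total_rec_subn.
Qed.

Lemma total_rec_big (op : Monoid.law 0) N (G : nat -> (nat -> nat) -> nat) :
  (forall A B, total_rec A -> total_rec B ->
     total_rec (fun rho => op (A rho) (B rho))) ->
  total_rec N -> total_rec (fun rho => G (rho 0) (fun i => rho i.+2)) ->
  total_rec (fun rho => \big[op/0]_(0 <= i < N rho) G i rho).
Proof.
move=> hop hN hG; apply: (@total_rec_ext
    (fun rho => iteri (N rho) (fun i a => op a (G i rho)) 0)).
  move=> rho; elim: (N rho) => [|n IHn] /=; first by rewrite big_geq.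
  by rewrite big_nat_recr //= IHn.
apply: total_rec_iteri => //; first exact: total_rec_const.
by apply: hop => //; exact: total_rec_var.
Qed.

Lemma total_rec_sum N (G : nat -> (nat -> nat) -> nat) :
  total_rec N -> total_rec (fun rho => G (rho 0) (fun i => rho i.+2)) ->
  total_rec (fun rho => \sum_(0 <= i < N rho) G i rho).
Proof. exact/total_rec_big/total_rec_addn. Qed.

Lemma total_rec_bigmax N (G : nat -> (nat -> nat) -> nat) :
  total_rec N -> total_rec (fun rho => G (rho 0) (fun i => rho i.+2)) ->
  total_rec (fun rho => \max_(0 <= i < N rho) G i rho).
Proof. exact/total_rec_big/total_rec_maxn. Qed.

Ltac total_rec_arith :=
  lazymatch goal with
  | |- total_rec (fun rho => addn _ _) => apply: total_rec_addn
  | |- total_rec (fun rho => subn _ _) => apply: total_rec_subn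
  | |- total_rec (fun rho => muln _ _) => apply: total_rec_muln
  | |- total_rec (fun rho => expn _ _) => apply: total_rec_expn
  | |- total_rec (fun rho => nat_of_bool (leq _ _)) => apply: total_rec_leq
  | |- total_rec (fun rho => nat_of_bool (eq_op _ _)) => apply: total_rec_eq
  | |- total_rec (fun rho => predn _) => apply: total_rec_predn
  | |- total_rec (fun rho => \sum_(0 <= i < _) _) => apply: total_rec_sum
  | |- total_rec (fun rho => \max_(0 <= i < _) _) => apply: total_rec_bigmax
  | |- _ => total_rec_step
  end.

(** Through this count, quotients, valuations and string lengths become bounded sums of a decidable
    condition, so closure under sums makes them recursive. *)
Lemma sum_ltn_id n t : t <= n -> \sum_(0 <= i < n) (i < t) = t.
Proof.
move=> tn; suff -> : \sum_(0 <= i < n) (i < t) = minn n t by lia.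
elim: n {tn} => [|n IHn]; first by rewrite big_geq // min0n.
by rewrite big_nat_recr //= IHn; lia.
Qed.

Lemma total_rec_divn F G : total_rec F -> total_rec G ->
  total_rec (fun rho => F rho %/ G rho).
Proof.
move=> hF hG; apply: (@total_rec_ext (fun rho =>
    (0 < G rho) * \sum_(0 <= i < F rho) (i.+1 * G rho <= F rho))).
  move=> rho; case: (posnP (G rho)) => [->|G0]; first by rewrite divn0.
  rewrite mul1n -[RHS](sum_ltn_id (leq_div (F rho) (G rho))).
  by apply: eq_bigr => i _; rewrite leq_divRL.
by do !total_rec_arith.
Qed.

Lemma total_rec_modn F G : total_rec F -> total_rec G ->
  total_rec (fun rho => F rho %% G rho).
Proof.
move=> hF hG; apply: (@total_rec_ext
    (fun rho => F rho - F rho %/ G rho * G rho)).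
  by move=> rho; rewrite {1}(divn_eq (F rho) (G rho)) addKn.
by do ![apply: total_rec_divn | total_rec_arith].
Qed.

Lemma total_rec_logn p F : prime p -> total_rec F ->
  total_rec (fun rho => logn p (F rho)).
Proof.
move=> p_pr hF; apply: (@total_rec_ext (fun rho =>
    (0 < F rho) * \sum_(0 <= i < F rho) (F rho %% p ^ i.+1 == 0))).
  move=> rho; case: (posnP (F rho)) => [->|F0]; first by rewrite logn0.
  rewrite mul1n -[RHS](@sum_ltn_id (F rho)); last exact/ltnW/ltn_logl.
  by apply: eq_bigr => i _; rewrite -/(dvdn _ _) pfactor_dvdn.
by do ![total_rec_arith | apply: total_rec_modn].
Qed.

(* The length of the binary string numbered x. *)
Definition strlen (x : nat) : nat := trunc_log 2 x.+1.

Lemma strlen_bounds x : 2 ^ strlen x <= x.+1 < 2 ^ (strlen x).+1.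
Proof. exact: trunc_log_bounds. Qed.

Lemma strlen_eq x n : 2 ^ n <= x.+1 < 2 ^ n.+1 -> strlen x = n.
Proof. by move=> h; apply: trunc_log_eq. Qed.

Lemma strlen_leq x : strlen x <= x.
Proof.
have /andP[h _] := strlen_bounds x.
by have := ltn_expl (strlen x) (ltnSn 1); lia.
Qed.

Lemma total_rec_strlen F : total_rec F ->
  total_rec (fun rho => strlen (F rho)).
Proof.
move=> hF; apply: (@total_rec_ext (fun rho =>
    \sum_(0 <= i < F rho) (2 ^ i.+1 <= (F rho).+1))).
  move=> rho; rewrite -[RHS](sum_ltn_id (strlen_leq (F rho))).
  apply: eq_bigr => i _; congr nat_of_bool.
  have /andP[h1 h2] := strlen_bounds (F rho).
  case: (ltnP i (strlen (F rho))) => hi.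
    by apply: leq_trans h1; rewrite leq_exp2l.
  apply/negbTE; rewrite -ltnNge; apply: leq_trans h2 _.
  by rewrite leq_exp2l.
by do !total_rec_arith.
Qed.

(** * Bounded simulation of partial recursive functions *)

Lemma total_rec_prod_ord m (W : 'I_m -> (nat -> nat) -> nat) :
  (forall i, total_rec (W i)) -> total_rec (fun rho => \prod_(i < m) W i rho).
Proof.
elim: m W => [|m IHm] W hW.
  apply: (@total_rec_ext (fun _ => 1)); last exact: total_rec_const.
  by move=> rho; rewrite big_ord0.
apply: (@total_rec_ext
    (fun rho => W ord0 rho * \prod_(i < m) W (lift ord0 i) rho)).
  by move=> rho; rewrite big_ord_recl.
by apply: total_rec_muln => //; apply: IHm.
Qed.

(* 0 means that no value is found within the bound T, and y.+1 that the value
   is y. The bound T limits every unbounded search. *)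
Fixpoint sim k (e : recfun k) (T : nat) (rho : nat -> nat) : nat :=
  match e with
  | RZero _ => 1
  | RSucc => (rho 0).+2
  | RProj _ i => (rho i).+1
  | RComp _ m h g =>
      (0 < \prod_(i < m) sim (g i) T rho) *
      sim h T (fun i => if insub i is Some j then (sim (g j) T rho).-1 else 0)
  | RPrec _ f g =>
      iteri (rho 0) (fun i a =>
        (0 < a) * sim g T (scons i (scons a.-1 (fun j => rho j.+1))))
        (sim f T (fun j => rho j.+1))
  | RMu _ f =>
      \sum_(0 <= y < T) (sim f T (scons y rho) == 1) *
        (\sum_(0 <= z < y) (sim f T (scons z rho) <= 1) == 0) * y.+1
  end.

(** The environment is an arbitrary computable [X] because composition, recursion and search all
    change it, and the induction hypothesis must apply to the changed one. *)
Lemma total_rec_sim k (e : recfun k) T X :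
  total_rec T -> (forall i, total_rec (fun rho => X rho i)) ->
  total_rec (fun rho => sim e (T rho) (X rho)).
Proof.
elim: e T X => {k} [k||k i|k m h IHh g IHg|k f IHf g IHg|k f IHf] T X hT hX /=.
- exact: total_rec_const.
- by do 2!apply: total_rec_succ.
- exact: total_rec_succ.
- apply: total_rec_muln.
    apply: total_rec_leq; first exact: total_rec_const.
    by apply: total_rec_prod_ord => i; apply: IHg.
  apply: IHh => // i; case: insub => [j|]; last exact: total_rec_const.
  exact/total_rec_predn/IHg.
- apply: total_rec_iteri => //; first by apply: IHf.
  apply: total_rec_muln; first by do !total_rec_arith.
  apply: IHg; first exact: (total_rec_shift2 hT).
  case=> [|[|i]] /=; first by do !total_rec_arith.
    by do !total_rec_arith.
  exact: (total_rec_shift2 (hX i.+1)).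
- apply: total_rec_sum => //; do ![apply: total_rec_muln].
  + apply: total_rec_eq; last exact: total_rec_const.
    apply: IHf => [|[|i] /=]; first exact: (total_rec_shift2 hT).
      exact: total_rec_var.
    exact: (total_rec_shift2 (hX i)).
  + apply: total_rec_eq; last exact: total_rec_const.
    apply: total_rec_sum; first exact: total_rec_var.
    apply: total_rec_leq; last exact: total_rec_const.
    apply: IHf => [|[|i] /=].
    * exact: (total_rec_shift2 (total_rec_shift2 hT)).
    * exact: total_rec_var.
    * exact: (total_rec_shift2 (total_rec_shift2 (hX i))).
  + by do !total_rec_arith.
Qed.

Lemma nth_mktuple_insub m (f : 'I_m -> nat) :
  (fun i => if insub i is Some j then f j else 0) = nth 0 (mktuple f).
Proof.
apply: funext => i; case: insubP => [j _ <-|]; last first.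
  by rewrite -leqNgt => mi; rewrite nth_default // size_tuple.
by rewrite -tnth_nth tnth_mktuple.
Qed.

Lemma nth_behead_tuple k (v : k.+1.-tuple nat) :
  (fun j => nth 0 v j.+1) = nth 0 [tuple of behead v].
Proof. by apply: funext => i; rewrite nth_behead. Qed.

Lemma nth0_thead k (v : k.+1.-tuple nat) : nth 0 v 0 = thead v.
Proof. by rewrite /thead (tnth_nth 0). Qed.

(** At most one index passes both tests, so the sum has at most one nonzero term. An earlier [s z]
    must exceed 1 because 0 codes no value and 1 codes the value 0. *)
Lemma sum_first_found T (s : nat -> nat) y :
  \sum_(0 <= x < T) (s x == 1) * (\sum_(0 <= z < x) (s z <= 1) == 0) * x.+1
    = y.+1 <->
  [/\ y < T, s y = 1 & forall z, z < y -> 1 < s z].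
Proof.
pose c x := (s x == 1) && (\sum_(0 <= z < x) (s z <= 1) == 0).
have cP x : c x <-> s x = 1 /\ forall z, z < x -> 1 < s z.
  rewrite /c; split=> [/andP[/eqP s1]|[-> h]].
    rewrite sum_nat_seq_eq0 => /allP h; split=> // z zx.
    have := h z; rewrite mem_index_iota zx => /(_ isT).
    by rewrite eqb0 -ltnNge.
  rewrite eqxx /= sum_nat_seq_eq0; apply/allP => z.
  by rewrite mem_index_iota => /andP[_ /h]; rewrite eqb0 -ltnNge.
have c_uniq x z : c x -> c z -> x = z.
  move=> /cP[sx hx] /cP[sz hz]; apply/eqP.
  rewrite eqn_leq leqNgt [z <= x]leqNgt.
  apply/andP; split; apply/negP; first by move/hx; rewrite sz.
  by move/hz; rewrite sx.
have sumE x : x < T -> c x ->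
    \sum_(0 <= x < T) (s x == 1) * (\sum_(0 <= z < x) (s z <= 1) == 0) * x.+1
      = x.+1.
  move=> xT cx; rewrite (bigD1_seq x) ?mem_index_iota ?iota_uniq //=.
  rewrite mulnb -/(c x) cx mul1n big1 ?addn0 // => z zx.
  rewrite mulnb -/(c z); case cz: (c z) => //.
  by rewrite (c_uniq _ _ cz cx) eqxx in zx.
split=> [h|[yT sy hy]]; last by apply: sumE => //; apply/cP.
have [x xT cx] : exists2 x, x < T & c x.
  apply: contrapT => nc; move: h; rewrite big_nat big1 // => x /andP[_ xT].
  rewrite mulnb -/(c x); case cx: (c x) => //; by case: nc; exists x.
by move: h; rewrite (sumE x) // => -[<-]; case/cP: cx.
Qed.

Lemma sim_sound k (e : recfun k) T (v : k.-tuple nat) y :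
  sim e T (nth 0 v) = y.+1 -> reval e v y.
Proof.
elim: e v y => {k} [k||k i|k m h IHh g IHg|k f IHf g IHg|k f IHf] v y /=.
- by case.
- by rewrite nth0_thead => -[].
- by rewrite (tnth_nth 0) => -[].
- rewrite (nth_mktuple_insub (fun j => (sim (g j) T (nth 0 v)).-1)).
  case: (posnP (\prod_(i < m) _)) => // hp.
  rewrite mul1n => /IHh hy; eexists; last exact: hy.
  move=> i; rewrite tnth_mktuple; apply: IHg; rewrite prednK //.
  by move: hp; rewrite (bigD1 i) //= muln_gt0 => /andP[].
- rewrite nth0_thead nth_behead_tuple; move: [tuple of behead v] => w.
  elim: (thead v) y => [|n IHn] y /=; first exact: IHf.
  move E: (iteri n _ _) => a; case: a E => // a /IHn ha.
  rewrite mul1n -!nth_scons => hy; exists a => //.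
  exact: (IHg [tuple of n :: a :: w]).
- move/sum_first_found => [_ sy hz]; split.
    by apply: IHf; rewrite nth_scons.
  move=> z /hz; case s: (sim f T (scons z (nth 0 v))) => [|[|t]] // _.
  by exists t; apply: IHf; rewrite nth_scons.
Qed.

Lemma sim_complete k (e : recfun k) (v : k.-tuple nat) y : reval e v y ->
  exists T0, forall T, T0 <= T -> sim e T (nth 0 v) = y.+1.
Proof.
elim: e v y => {k} [k||k i|k m h IHh g IHg|k f IHf g IHg|k f IHf] v y /=.
- by move=> ->; exists 0.
- by move=> ->; exists 0 => T _; rewrite nth0_thead.
- by move=> ->; exists 0 => T _; rewrite (tnth_nth 0).
- move=> [w hw /IHh [T1 hT1]].
  have /fin_all_exists [T2 hT2] : forall i, exists T0, forall T, T0 <= T ->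
      sim (g i) T (nth 0 v) = (tnth w i).+1 by move=> i; apply: IHg.
  exists (maxn T1 (\max_i T2 i)) => T; rewrite geq_max => /andP[T1T T2T].
  have sg i : sim (g i) T (nth 0 v) = (tnth w i).+1.
    by apply: hT2; apply: leq_trans T2T; apply: leq_bigmax.
  rewrite (nth_mktuple_insub (fun j => (sim (g j) T (nth 0 v)).-1)).
  rewrite (_ : mktuple _ = w); last first.
    by apply: eq_from_tnth => i; rewrite tnth_mktuple sg.
  by rewrite prodn_gt0 ?mul1n ?hT1 // => i; rewrite sg.
- rewrite nth0_thead nth_behead_tuple; move: [tuple of behead v] => w.
  elim: (thead v) y => [|n IHn] y /=; first exact: IHf.
  move=> [z /IHn[T1 hT1] /IHg[T2 hT2]]; exists (maxn T1 T2) => T.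
  rewrite geq_max => /andP[/hT1 -> /hT2].
  by rewrite mul1n -!nth_scons.
- move=> [/IHf[T1 hT1] hz].
  have /fin_all_exists [T2 hT2] : forall z : 'I_y, exists T0, forall T,
      T0 <= T -> 1 < sim f T (scons z (nth 0 v)).
    move=> z; have [t /IHf[T0 hT0]] := hz z (ltn_ord z).
    by exists T0 => T /hT0; rewrite nth_scons => ->.
  (* The bound must exceed [y] itself for the search to reach it, and also the thresholds of the
     evaluations at [y] and at every smaller argument. *)
  exists (maxn y.+1 (maxn T1 (\max_z T2 z))) => T.
  rewrite !geq_max => /and3P[yT /hT1 sy T2T]; apply/sum_first_found; split=> //.
    by rewrite -nth_scons.
  move=> z zy; apply: (hT2 (Ordinal zy)); apply: leq_trans T2T.
  exact: leq_bigmax.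
Qed.

(** Determinism is read off the simulation: at a common large bound it returns both values. *)
Lemma reval_functional k (e : recfun k) (v : k.-tuple nat) y z :
  reval e v y -> reval e v z -> y = z.
Proof.
move=> /sim_complete[T1 h1] /sim_complete[T2 h2].
have := h1 _ (leq_maxl T1 T2).
by rewrite h2 ?leq_maxr // => -[].
Qed.

(* Taking the maximum over all smaller bounds makes the simulation monotone in
   its bound. *)
Definition run_within (U : recfun 2) (T p y : nat) : nat :=
  \max_(0 <= t < T) sim U t (nth 0 [:: p; y]).

Lemma total_rec_run_within U T P Y :
  total_rec T -> total_rec P -> total_rec Y ->
  total_rec (fun rho => run_within U (T rho) (P rho) (Y rho)).
Proof.
move=> hT hP hY; apply: total_rec_bigmax => //.
apply: total_rec_sim => [|[|[|i]] /=]; try exact: total_rec_var.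
- exact: (total_rec_shift2 hP).
- exact: (total_rec_shift2 hY).
- by rewrite nth_nil; apply: total_rec_const.
Qed.

Lemma run_within_mono U T T' p y : T <= T' ->
  run_within U T p y <= run_within U T' p y.
Proof.
move=> TT'; rewrite /run_within (big_cat_nat (leq0n _) TT') /=.
exact: leq_maxl.
Qed.

Lemma run_withinP U T p y x : run_within U T p y = x.+1 ->
  reval U [tuple p; y] x.
Proof.
move=> h; have [t] : exists t, sim U t (nth 0 [:: p; y]) = x.+1; last first.
  exact: (@sim_sound _ U t [tuple p; y]).
move: h; rewrite /run_within; elim: T => [|T IHT]; first by rewrite big_geq.
rewrite big_nat_recr //= /maxn; case: ltnP => // _; by [exists T | apply: IHT].
Qed.

Lemma run_within_complete U p y x : reval U [tuple p; y] x ->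
  exists T, forall T', T <= T' -> run_within U T' p y = x.+1.
Proof.
move=> hx; have [T0 hT0] := sim_complete hx; exists T0.+1 => T lT.
have : x < run_within U T p y.
  apply: leq_trans (run_within_mono _ _ _ lT).
  by rewrite /run_within big_nat_recr //= hT0 // leq_maxr.
case E: (run_within U T p y) => [//|z] _.
by rewrite (reval_functional (run_withinP E) hx).
Qed.

Definition least_zero (G : nat -> nat) (T : nat) : Prop :=
  G T = 0 /\ forall z, z < T -> 0 < G z.

Lemma least_zero_ex (G : nat -> nat) T :
  G T = 0 -> exists2 T', least_zero G T' & T' <= T.
Proof.
move=> GT; have exT : exists T, G T == 0 by exists T; apply/eqP.
case: (ex_minnP exT) => T' /eqP GT' minT; exists T'; last exact/minT/eqP.
split=> // z zT; rewrite lt0n; apply/negP => /minT.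
by rewrite leqNgt zT.
Qed.

(** The common shape of both machines below: find the first stage T that passes a test, then compute
    from it. Entry 0 of the environment is the stage, entry 1 the program and entry 2 the
    condition. *)
Lemma search_machine (G F : (nat -> nat) -> nat) :
  total_rec G -> total_rec F ->
  exists M : recfun 2, forall w y T,
    least_zero (fun t => G (nth 0 [:: t; w; y])) T ->
    reval M [tuple w; y] (F (nth 0 [:: T; w; y])).
Proof.
move=> hG hF; have [g hg] := hG 3; have [f hf] := hF 3.
exists (RComp f (fun i => if unlift ord0 i is Some j then RProj j else RMu g)).
move=> w y T [GT minT] /=; exists [tuple T; w; y]; last exact: hf.
move=> i; case: unliftP => [j ->|->] /=; first by rewrite !(tnth_nth 0).
split; first by have := hg [tuple T; w; y]; rewrite GT.
move=> z zT; exists (G (nth 0 [:: z; w; y])).-1.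
rewrite prednK; last exact: minT.
exact: (hg [tuple z; w; y]).
Qed.

(** * Coding strings and tuples of strings by numbers *)

Lemma strnum_rcons s b : strnum (rcons s b) = (strnum s).*2 + b.+1.
Proof. by rewrite /strnum foldl_rcons. Qed.

Lemma strlen_strnum s : strlen (strnum s) = size s.
Proof.
apply: strlen_eq; elim/last_ind: s => [//|s b /andP[h1 h2]].
by move: h1 h2; rewrite strnum_rcons size_rcons !expnS; case: b; lia.
Qed.

Lemma strnum_surj x : exists s, strnum s = x.
Proof.
elim/ltn_ind: x => -[|x] IHx; first by exists [::].
have [|s hs] := IHx x./2; first lia.
by exists (rcons s (odd x)); rewrite strnum_rcons hs; lia.
Qed.

(* In string notation, r followed by 0 1^m. *)
Definition utag (m r : nat) : nat := 2 ^ m * (2 * r + 3) - 2.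
Definition utag_fst (w : nat) : nat := logn 2 w.+2.
Definition utag_snd (w : nat) : nat := (w.+2 %/ 2 ^ utag_fst w - 3) %/ 2.

(** Appending the digit 1 sends n to 2n + 2 and so doubles n + 2, while appending 0 makes n + 2 odd.
    Hence m is the exponent of 2 in this number. *)
Lemma utagSS m r : (utag m r).+2 = 2 ^ m * (2 * r + 3).
Proof. by rewrite /utag; have := expn_gt0 2 m; nia. Qed.

Lemma utag_fstK m r : utag_fst (utag m r) = m.
Proof.
rewrite /utag_fst utagSS lognM ?expn_gt0 ?addn_gt0 ?orbT // pfactorK //.
by rewrite logn_coprime ?addn0 // coprime2n; lia.
Qed.

Lemma utag_sndK m r : utag_snd (utag m r) = r.
Proof.
by rewrite /utag_snd utag_fstK utagSS mulKn ?expn_gt0 // addnK mulKn.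
Qed.

Lemma strlen_utag m r : strlen (utag m r) = strlen r + m + 1.
Proof.
apply: strlen_eq; have /andP[h1 h2] := strlen_bounds r.
have := utagSS m r; have := expn_gt0 2 m.
by rewrite addn1 !expnS expnD; rewrite expnS in h2; nia.
Qed.

(* In string notation, r followed by s 0 1^(length of s). *)
Definition attach (s r : nat) : nat :=
  utag (strlen s) (r * 2 ^ strlen s + s).
Definition attach_fst (w : nat) : nat :=
  ((utag_snd w).+1 - 2 ^ utag_fst w) %% 2 ^ utag_fst w + 2 ^ utag_fst w - 1.
Definition attach_snd (w : nat) : nat :=
  ((utag_snd w).+1 - 2 ^ utag_fst w) %/ 2 ^ utag_fst w.

(** Strings of length l have numbers from 2^l - 1 to 2^(l+1) - 2, so it is s + 1 - 2^l, and not s,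
    that is a remainder modulo 2^l. *)
Lemma attach_offset s r :
  (r * 2 ^ strlen s + s).+1 - 2 ^ strlen s =
  r * 2 ^ strlen s + (s.+1 - 2 ^ strlen s).
Proof. by have /andP[h1 _] := strlen_bounds s; lia. Qed.

Lemma attach_fstK s r : attach_fst (attach s r) = s.
Proof.
rewrite /attach_fst utag_fstK utag_sndK attach_offset modnMDl.
have /andP[h1 h2] := strlen_bounds s; rewrite expnS in h2.
by rewrite modn_small; lia.
Qed.

Lemma attach_sndK s r : attach_snd (attach s r) = r.
Proof.
rewrite /attach_snd utag_fstK utag_sndK attach_offset.
have /andP[h1 h2] := strlen_bounds s; rewrite expnS in h2.
by rewrite divnMDl ?expn_gt0 // divn_small ?addn0; lia.
Qed.

(** Attaching s costs twice its length: this is the origin of the term 2 log c and of the overhead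
    2|b|. *)
Lemma strlen_attach s r : strlen (attach s r) = strlen r + 2 * strlen s + 1.
Proof.
rewrite strlen_utag.
suff -> : strlen (r * 2 ^ strlen s + s) = strlen r + strlen s by lia.
apply: strlen_eq; have /andP[h1 h2] := strlen_bounds s.
have /andP[h3 h4] := strlen_bounds r.
by move: h2 h4; rewrite !expnS expnD; nia.
Qed.

Lemma total_rec_utag_fst F :
  total_rec F -> total_rec (fun rho => utag_fst (F rho)).
Proof. by move=> hF; apply: total_rec_logn => //; do !total_rec_arith. Qed.

Lemma total_rec_utag_snd F :
  total_rec F -> total_rec (fun rho => utag_snd (F rho)).
Proof.
move=> hF; do ![apply: total_rec_divn | total_rec_arith].
exact: total_rec_utag_fst.
Qed.

Lemma total_rec_attach_fst F :
  total_rec F -> total_rec (fun rho => attach_fst (F rho)).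
Proof.
move=> hF; rewrite /attach_fst.
have h1 := total_rec_utag_fst hF; have h2 := total_rec_utag_snd hF.
by do ![total_rec_arith | apply: total_rec_modn].
Qed.

Lemma total_rec_attach_snd F :
  total_rec F -> total_rec (fun rho => attach_snd (F rho)).
Proof.
move=> hF; rewrite /attach_snd.
have h1 := total_rec_utag_fst hF; have h2 := total_rec_utag_snd hF.
by apply: total_rec_divn; do !total_rec_arith.
Qed.

(** * Approximations computed by a program *)

(* floor (2^n (r - (z1 - z2))), or 0 when this is negative, for the rational r
   with code m. *)
Definition shifted_floor (z1 z2 m n : nat) : nat :=
  2 ^ n * (logn 2 m + z2 * (logn 5 m).+1 - (logn 3 m + z1 * (logn 5 m).+1))
    %/ (logn 5 m).+1.

(** A lower approximation, as an integer, of the first n digits after removal of the integer part z1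
    - z2. The first factor discards the indices at which [b] has not yet produced a rational. *)
Definition stage_approx (U : recfun 2) (z1 z2 T b n : nat) : nat :=
  \max_(0 <= k < T) (0 < run_within U T b k) *
                    shifted_floor z1 z2 (run_within U T b k).-1 n.

Lemma total_rec_shifted_floor z1 z2 M N : total_rec M -> total_rec N ->
  total_rec (fun rho => shifted_floor z1 z2 (M rho) (N rho)).
Proof.
move=> hM hN; rewrite /shifted_floor.
have h2 := @total_rec_logn 2 _ isT hM.
have h3 := @total_rec_logn 3 _ isT hM.
have h5 := @total_rec_logn 5 _ isT hM.
by apply: total_rec_divn; do !total_rec_arith.
Qed.

Lemma total_rec_stage_approx U z1 z2 T B N :
  total_rec T -> total_rec B -> total_rec N ->
  total_rec (fun rho => stage_approx U z1 z2 (T rho) (B rho) (N rho)).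
Proof.
move=> hT hB hN; rewrite /stage_approx; apply: total_rec_bigmax => //.
have h := total_rec_run_within U (total_rec_shift2 hT) (total_rec_shift2 hB)
  (total_rec_var 0).
apply: total_rec_muln; first by do !total_rec_arith.
by apply: total_rec_shifted_floor; do !total_rec_arith.
Qed.

Lemma stage_approx_mono U z1 z2 T T' b n : T <= T' ->
  stage_approx U z1 z2 T b n <= stage_approx U z1 z2 T' b n.
Proof.
move=> TT'; rewrite /stage_approx.
rewrite [leqRHS](big_cat_nat (leq0n _) TT') /= leq_max.
apply/orP; left; rewrite !big_mkord; apply/bigmax_leqP => k _.
apply: leq_trans (leq_bigmax k).
case E: (run_within U T b k) => [//|x].

have := run_within_mono U b k TT'; rewrite E.
case E': (run_within U T' b k) => [//|x'] _.
by rewrite (reval_functional (run_withinP E) (run_withinP E')).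
Qed.

(** * The two machines *)

(* If the program q halts late, its halting time reveals beta_n up to one bit
   j. *)
Lemma late_machine U z1 z2 : exists V : recfun 2, forall b j q x y T,
  least_zero (fun t => (run_within U t q 0 == 0 : nat)) T ->
  run_within U T q 0 = x.+1 ->
  reval V [tuple attach b (utag j q); y]
    (2 ^ strlen x - 1 + stage_approx U z1 z2 (T + q) b (strlen x) + j).
Proof.
pose B (rho : nat -> nat) := attach_fst (rho 1).
pose J (rho : nat -> nat) := utag_fst (attach_snd (rho 1)).
pose Q (rho : nat -> nat) := utag_snd (attach_snd (rho 1)).
pose E (rho : nat -> nat) := run_within U (rho 0) (Q rho) 0.
pose N (rho : nat -> nat) := strlen (E rho).-1.
have hB : total_rec B by apply: total_rec_attach_fst; apply: total_rec_var.
have hS : total_rec (fun rho => attach_snd (rho 1)).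
  by apply: total_rec_attach_snd; apply: total_rec_var.
have hJ : total_rec J := total_rec_utag_fst hS.
have hQ : total_rec Q := total_rec_utag_snd hS.
have hE : total_rec E.
  by apply: total_rec_run_within => //; do !total_rec_arith.
have hN : total_rec N by apply: total_rec_strlen; do !total_rec_arith.
have hA : total_rec (fun rho =>
    stage_approx U z1 z2 (rho 0 + Q rho) (B rho) (N rho)).
  by apply: total_rec_stage_approx => //; do !total_rec_arith.
(* The search finds the stage at which q halts. Its output reveals n, and 2^n - 1 + a is the number
   of the n-digit string with binary value a. *)
have [||V hV] := @search_machine (fun rho => E rho == 0) (fun rho =>
    2 ^ N rho - 1 + stage_approx U z1 z2 (rho 0 + Q rho) (B rho) (N rho)
      + J rho).
- by do !total_rec_arith.
- by do !total_rec_arith.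
exists V => b j q x y T hT ET.
have := hV (attach b (utag j q)) y T.
rewrite /N /E /B /J /Q /= attach_fstK attach_sndK utag_fstK utag_sndK.
by rewrite ET /=; apply.
Qed.

(* If every shortest program halts early, the stage reached by the
   approximation of beta_n = y suffices to compute C(x), for x = p(y). *)
Lemma early_machine U z1 z2 : exists V : recfun 2, forall m c b p y T,
  least_zero (fun t => 1 - (y.+1 - 2 ^ strlen y
                             <= (stage_approx U z1 z2 t b (strlen y)).+1) *
                           (0 < run_within U t p y)) T ->
  reval V [tuple utag m (attach c (attach b p)); y]
    (c + 2 ^ m + (T - \max_(0 <= q < T)
       (run_within U T q 0 == run_within U T p y) * (T - strlen q))).
Proof.
pose S1 (rho : nat -> nat) := utag_snd (rho 1).
pose S2 (rho : nat -> nat) := attach_snd (S1 rho).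
pose M (rho : nat -> nat) := utag_fst (rho 1).
pose C (rho : nat -> nat) := attach_fst (S1 rho).
pose B (rho : nat -> nat) := attach_fst (S2 rho).
pose P (rho : nat -> nat) := attach_snd (S2 rho).
have h1 : total_rec S1 by apply: total_rec_utag_snd; apply: total_rec_var.
have h2 : total_rec S2 := total_rec_attach_snd h1.
have hM : total_rec M by apply: total_rec_utag_fst; apply: total_rec_var.
have hC : total_rec C := total_rec_attach_fst h1.
have hB : total_rec B := total_rec_attach_fst h2.
have hP : total_rec P := total_rec_attach_snd h2.
have v0 := total_rec_var 0; have v2 := total_rec_var 2.
have hL := total_rec_strlen v2.
have hA : total_rec (fun rho =>
    stage_approx U z1 z2 (rho 0) (B rho) (strlen (rho 2))).
  exact: total_rec_stage_approx.
have hR : total_rec (fun rho => run_within U (rho 0) (P rho) (rho 2)).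
  exact: total_rec_run_within.
have hX : total_rec (fun rho => run_within U (rho 2) (rho 0) 0).
  by apply: total_rec_run_within; do !total_rec_arith.
have hl := total_rec_strlen v0.
(* The test vanishes exactly when the approximation is within one unit and p has halted. In the
   result, a minimum of program lengths is written as T minus a maximum of T - |q|. *)
have [||V hV] := @search_machine (fun rho =>
    1 - ((rho 2).+1 - 2 ^ strlen (rho 2)
           <= (stage_approx U z1 z2 (rho 0) (B rho) (strlen (rho 2))).+1) *
        (0 < run_within U (rho 0) (P rho) (rho 2)))
  (fun rho => C rho + 2 ^ M rho + (rho 0 - \max_(0 <= q < rho 0)
     (run_within U (rho 0) q 0 == run_within U (rho 0) (P rho) (rho 2)) *
     (rho 0 - strlen q))).
- by do !total_rec_arith.
- do !total_rec_arith.
exists V => m c b p y T.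
have := hV (utag m (attach c (attach b p))) y T.
rewrite /C /M /B /P /S2 /S1 /= utag_fstK utag_sndK attach_sndK !attach_fstK.
by rewrite attach_sndK.
Qed.

(** * Binary digits and approximations of a real *)

Local Open Scope ring_scope.

Section Digits.
Variables (R : realType) (x : R) (z1 z2 : nat).
(** The fractional part of [x]; its integer part is a difference of naturals, so that machines can
    handle it with natural numbers. *)
Let g := x - (z1%:R - z2%:R).
Hypothesis g01 : 0 <= g < 1.

Let v n := Num.truncn (2 ^+ n * g).

Let g_ge0 n : 0 <= 2 ^+ n * g.
Proof. by case/andP: g01 => g0 _; rewrite mulr_ge0 ?exprn_ge0. Qed.

Lemma truncn_double n : v n.+1 = ((v n).*2 + odd (v n.+1))%N.
Proof.
have /andP[a1 a2] := truncn_itv (g_ge0 n).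
have /andP[b1 b2] := truncn_itv (g_ge0 n.+1).
move: a1 a2 b1 b2; rewrite -/(v n) -/(v n.+1) exprS -mulrA.
set y := 2 ^+ n * g => a1 a2 b1 b2.
have h1 : ((v n).*2 < (v n.+1).+1)%N.
  by rewrite -(ltr_nat R) -mul2n natrM; lra.
have h2 : (v n.+1 < (v n).*2.+2)%N.
  rewrite -(ltr_nat R) -doubleS -mul2n natrM -natr1 in a2 *; lra.
lia.
Qed.

(** Removing the integer part changes the floor of 2^(n+1) x by a multiple of 2^(n+1), which is
    even, so the parity stays. *)
Lemma digit_odd n : digit x n = odd (v n.+1).
Proof.
rewrite /digit; set y := 2 ^+ n.+1 * x.
suff -> : Num.floor y = (v n.+1)%:Z + 2 * (2 ^+ n * (z1%:Z - z2%:Z)) by lia.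
apply/eqP; rewrite floor_eq.
have /andP[b1 b2] := truncn_itv (g_ge0 n.+1); move: b1 b2; rewrite -/(v n.+1).
have -> : 2 ^+ n.+1 * g = y - 2 ^+ n.+1 * (z1%:R - z2%:R).
  by rewrite /y /g; ring.
rewrite exprS -!mulrA -natr1 => b1 b2.
rewrite !(intrD, intrM, rmorphXn, rmorphN) /= -!pmulrn -[1 + 1]/(2 : R).
set t := 2 ^+ n * _ in b1 b2 *.
by apply/andP; split; lra.
Qed.

Lemma digits_truncn n : (digits x n).+1 = (2 ^ n + v n)%N.
Proof.
elim: n => [|n IHn].
  rewrite /v expr0 mul1r; suff -> : Num.truncn g = 0%N by [].
  by apply: truncn_def; rewrite -[0%:R]/(0 : R).
rewrite /digits mkseqS strnum_rcons -/(digits x n) digit_odd truncn_double.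
by rewrite expnS; lia.
Qed.

End Digits.

Lemma ratr_rat_of_code (R : realType) m :
  ratr (rat_of_code m) =
  ((logn 2 m)%:R - (logn 3 m)%:R) / (logn 5 m).+1%:R :> R.
Proof.
by rewrite /rat_of_code fmorph_div rmorphB !rmorph_nat.
Qed.

(** For a negative difference the truncated subtraction gives 0; then both sides are false, because
    [u] is positive. *)
Lemma leq_shifted_floor (R : realType) z1 z2 m n u : (0 < u)%N ->
  (u <= shifted_floor z1 z2 m n)%N =
  (u%:R <= 2 ^+ n * (ratr (rat_of_code m) - (z1%:R - z2%:R)) :> R).
Proof.
move=> u0; rewrite ratr_rat_of_code /shifted_floor leq_divRL //.
set a := logn 2 m; set b := logn 3 m; set c := (logn 5 m).+1.
have c0 : 0 < c%:R :> R by rewrite ltr0n.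
rewrite -(ler_pM2r c0) -mulrA.
have -> : ((a%:R - b%:R) / c%:R - (z1%:R - z2%:R)) * c%:R =
   (a + z2 * c)%:R - (b + z1 * c)%:R :> R.
  rewrite !natrD !natrM; field; exact: lt0r_neq0.
case: (leqP (b + z1 * c) (a + z2 * c)) => h.
  by rewrite -natrB // -natrX -!natrM ler_nat.
have -> : (a + z2 * c - (b + z1 * c) = 0)%N by lia.
rewrite muln0; have -> : (u * c <= 0)%N = false by nia.
apply/esym/negbTE; rewrite -ltNge.
apply: (@lt_le_trans _ _ 0); last by rewrite mulr_ge0 // ltW // ltr0n.
by rewrite pmulr_rlt0 ?exprn_gt0 // subr_lt0 ltr_nat.
Qed.

Section StageApprox.
Variables (R : realType) (x : R) (z1 z2 : nat) (U : recfun 2) (b : seq bool).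
Variable f : nat -> nat.
Hypotheses (bf : forall k, runs U b k (f k)) (fx : approx_below f x).
Let g := x - (z1%:R - z2%:R).
Hypothesis g01 : 0 <= g < 1.

Let g_ge0 n : 0 <= 2 ^+ n * g.
Proof. by case/andP: g01 => g0 _; rewrite mulr_ge0 ?exprn_ge0. Qed.

Lemma approx_below_le k : ratr (rat_of_code (f k)) <= x.
Proof.
case: fx => mono cvg.
rewrite -(cvg_lim _ cvg) //; apply: nondecreasing_cvgn_le; last first.
  by apply/cvg_ex; exists x.
by move=> i j ij; rewrite ler_rat; apply: mono.
Qed.

Lemma stage_approx_le T n :
  (stage_approx U z1 z2 T (strnum b) n <= Num.truncn (2 ^+ n * g))%N.
Proof.
rewrite /stage_approx big_mkord; apply/bigmax_leqP => k _.
case E: (run_within U T (strnum b) k) => [//|y].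
rewrite (reval_functional (run_withinP E) (bf k)) mul1n /=.
case: (posnP (shifted_floor z1 z2 (f k) n)) => [->//|h].
rewrite truncn_ge_nat //.
have := leqnn (shifted_floor z1 z2 (f k) n).
rewrite {1}(leq_shifted_floor R) // => /le_trans; apply.
by rewrite ler_pM2l ?exprn_gt0 // lerD2r approx_below_le.
Qed.

(** With w the truncation, (w - 1) / 2^n plus the integer part lies strictly below [x], even if 2^n
    g is an integer, so the convergent rationals pass it. *)
Lemma stage_approx_ge n : exists T,
  (Num.truncn (2 ^+ n * g) <= (stage_approx U z1 z2 T (strnum b) n).+1)%N.
Proof.
set w := Num.truncn _; case: (posnP w.-1) => [w0|w0]; first by exists 0%N; lia.
have /andP[w1 _] := truncn_itv (g_ge0 n).
have lt_x : w.-1%:R / 2 ^+ n + (z1%:R - z2%:R) < x.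
  rewrite -ltrBrDr -/g ltr_pdivrMr ?exprn_gt0 // mulrC.
  by apply: lt_le_trans w1; rewrite ltr_nat -/w; lia.
case: fx => _ cvg.
have [k hk] : exists k, w.-1%:R / 2 ^+ n + (z1%:R - z2%:R) <
    ratr (rat_of_code (f k)) :> R.
  have := cvgr_gt _ cvg _ lt_x => -[N _ hN]; exists N; exact: (hN N (leqnn N)).
have h : (w.-1 <= shifted_floor z1 z2 (f k) n)%N.
  rewrite (leq_shifted_floor R) // mulrC -ler_pdivrMr ?exprn_gt0 //.
  by rewrite lerBrDr ltW.
have [T hT] := run_within_complete (bf k).
exists (maxn T k.+1); rewrite /stage_approx big_mkord.
have kT : (k < maxn T k.+1)%N by rewrite leq_max leqnn orbT.
have := leq_bigmax (F := fun i : 'I_(maxn T k.+1) =>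
  ((0 < run_within U (maxn T k.+1) (strnum b) i) *
  shifted_floor z1 z2 (run_within U (maxn T k.+1) (strnum b) i).-1 n)%N)
  (Ordinal kT).
rewrite /= (hT _ (leq_maxl _ _)) mul1n /= => h'.
by have := leq_trans h h'; lia.
Qed.

End StageApprox.

(** * Complexity bounds *)

Lemma strlen_digits (R : realType) (x : R) n : strlen (digits x n) = n.
Proof. by rewrite /digits strlen_strnum size_mkseq. Qed.

Section Complexity.
Local Open Scope nat_scope.
Variable U : recfun 2.
Hypothesis U_optimal : additively_optimal U.

(** The machine that outputs its own program reaches every x; by optimality [U] does too, so the
    default value in [Ccond] never occurs. *)
Lemma runs_ex x y : exists p, runs U p y x.
Proof.
have [c hc] := U_optimal (RProj ord0).
have [p hp] := strnum_surj x.
by have [|p' hp' _] := hc p y x; [rewrite /runs /= (tnth_nth 0) | exists p'].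
Qed.

Lemma CcondP x y : (exists2 p, size p = Ccond U x y & runs U p y x) /\
                   (forall p, runs U p y x -> Ccond U x y <= size p).
Proof.
rewrite /Ccond; set P := [set k | _]; suff : P (xget 0 P) by [].
apply: xgetPex; pose Q k := `[< exists2 p, size p = k & runs U p y x >].
have [p0 hp0] := runs_ex x y.
have exQ : exists k, Q k by exists (size p0); apply/asboolP; exists p0.
case: (ex_minnP exQ) => k /asboolP hk mink; exists k; split=> // p hp.
by apply: mink; apply/asboolP; exists p.
Qed.

Lemma Ccond_machine V : exists c, forall w x y, reval V [tuple w; y] x ->
  Ccond U x y <= strlen w + c.
Proof.
have [c hc] := U_optimal V; exists c => w x y.
have [p <-] := strnum_surj w; rewrite strlen_strnum => h.
have [p' hp' le_p'] := hc p y x h.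
exact: leq_trans ((CcondP x y).2 _ hp') le_p'.
Qed.

(** No program counted in the maximum is shorter than C(x), and [q] itself is counted, since its
    number is below [T] and it has halted by then. *)
Lemma min_program_length T x q : runs U q 0 x -> size q = Cplain U x ->
  run_within U T (strnum q) 0 = x.+1 -> strnum q < T ->
  T - \max_(0 <= r < T) (run_within U T r 0 == x.+1) * (T - strlen r) =
  Cplain U x.
Proof.
move=> hq sq rq qT; set m := \max_(0 <= r < T) _.
suff -> : m = T - size q.
  by rewrite subKn // -strlen_strnum; apply: leq_trans (strlen_leq _) (ltnW qT).
rewrite /m big_mkord; apply/eqP; rewrite eqn_leq; apply/andP; split.
  apply/bigmax_leqP => r _; case: eqP => // /run_withinP.
  have [p <-] := strnum_surj r; rewrite strlen_strnum mul1n => hp.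
  by rewrite leq_sub2l // sq; apply: (CcondP x 0).2.
have := leq_bigmax (F := fun r : 'I_T =>
  (run_within U T r 0 == x.+1) * (T - strlen r)) (Ordinal qT).
by rewrite /= rq eqxx mul1n strlen_strnum.
Qed.

End Complexity.

Lemma strlen_log2 (R : realType) c : (strlen c)%:R <= log2 (c%:R : R) + 1.
Proof.
(* For c = 0 both the length and, by the convention for [ln 0], the logarithm are 0. Otherwise c + 1
   is at most 2c, which gives the additional 1. *)
case: c => [|c]; first by rewrite /log2 ln0 // mul0r add0r.
have ln2 : 0 < ln (2 : R) by rewrite ln_gt0 // ltr1n.
rewrite /log2 -[leRHS](mulfK (lt0r_neq0 ln2)) ler_pdivlMr //.
rewrite mulrDl mul1r divfK ?lt0r_neq0 // mulrC mulr_natr -lnXn //.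
rewrite -lnM ?posrE ?ltr0n // ler_ln ?posrE ?exprn_gt0 ?mulr_gt0 ?ltr0n //.
have /andP[h _] := strlen_bounds c.+1.
by rewrite -natrX -natrM ler_nat; lia.
Qed.

(** The constant d = 2^m with m = |b| + K must outweigh all overheads: 2|b| for attaching b, another
    |b| + K for writing m, the two machine constants and a few separators. *)
Lemma linear_lt_expn K x c1 c2 : (K = c1 + c2 + 10)%N ->
  (3 * x + K + c1 + c2 + 10 < 2 ^ (x + K))%N.
Proof.
move=> hK; have h n : (3 * (n + 4) < 2 ^ (n + 4))%N.
  by elim: n => // n IHn; rewrite addSn expnS; lia.
have := h (x + K - 4)%N; rewrite subnK; lia.
Qed.

(** The constant is a power of two because the early machine must be told it to recover C(beta_n),
    and the exponent m takes only m + 1 bits. [K] comes from the two machines alone, since they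
    receive [b] as input. *)
Lemma uniform_no_short_transformation (U : recfun 2) (z1 z2 : nat) :
  additively_optimal U ->
  exists K, forall (R : realType) (alpha beta : R) (b : seq bool),
    0 <= beta - (z1%:R - z2%:R) < 1 -> enumerates_below U b beta ->
    no_short_transformation U alpha beta (2 ^ (size b + K)).
Proof.
move=> U_opt.
have [V1 hV1] := late_machine U z1 z2; have [V2 hV2] := early_machine U z1 z2.
have [c1 hc1] := Ccond_machine U_opt V1.
have [c2 hc2] := Ccond_machine U_opt V2.
exists (c1 + c2 + 10)%N => R alpha beta b g01 [f bf fx] n c hC bound.
suff no_p p : (size p)%:R <= bound ->
    ~ runs U p (digits beta n) (digits alpha n).
  split=> //.
  have [[p sp rp] _] := CcondP U_opt (digits alpha n) (digits beta n).
  by rewrite -sp ltNge; apply/negP => /no_p.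
move=> le_p rp; set m := (size b + _)%N in hC bound le_p.
have := linear_lt_expn (size b) (erefl (c1 + c2 + 10)%N); rewrite -/m => lt_m.
set y := digits beta n in hC bound le_p rp *.
set x := digits alpha n in hC rp *.
pose v := Num.truncn (2 ^+ n * (beta - (z1%:R - z2%:R))).
have yE : y.+1 = (2 ^ n + v)%N := digits_truncn g01 n.
have [[q sq rq] _] := CcondP U_opt x 0.
pose q' := strnum q.
have [Tq0 hTq0] := run_within_complete rq.
have [Tq minTq _] : exists2 Tq,
    least_zero (fun t => (run_within U t q' 0 == 0)%N : nat) Tq & (Tq <= Tq0)%N.
  by apply: least_zero_ex; rewrite hTq0.
have rTq : run_within U Tq q' 0 = x.+1.
  case: minTq; case E: (run_within U Tq q' 0) => [//|u] _ _.
  by rewrite (reval_functional (run_withinP E) rq).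
pose good T := (v <= (stage_approx U z1 z2 T (strnum b) n).+1)%N.
(* The stage is [Tq + q'] rather than [Tq]: when the approximation is not yet good there, the stage
   [T] found later exceeds it, so by then [q] has halted and its number is below [T], as
   [min_program_length] requires. *)
case: (boolP (good (Tq + q')%N)) => [late|early].
  have le_v := stage_approx_le bf fx g01 (Tq + q') n.
  set A := stage_approx _ _ _ _ _ _ in le_v.
  (* The correction [v - A] is 0 or 1, because [A] never exceeds [v] and the stage is good. *)
  have := hV1 (strnum b) (v - A)%N q' x 0%N Tq minTq rTq.
  rewrite strlen_digits -/A => /hc1.
  have -> : (2 ^ n - 1 + A + (v - A) = y)%N.
    by move: le_v; rewrite -/v; have := expn_gt0 2 n; lia.
  rewrite strlen_attach strlen_utag !strlen_strnum sq => h.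
  have hl : (v <= A.+1)%N := late.
  move: h hC; rewrite /Cplain -[strnum [::]]/0%N => h hC.
  lia.
have [T0 hT0] := stage_approx_ge bf fx g01 n.
have [T1 hT1] := run_within_complete rp.
pose G t := (1 - (y.+1 - 2 ^ strlen y
   <= (stage_approx U z1 z2 t (strnum b) (strlen y)).+1) *
   (0 < run_within U t (strnum p) y))%N.
have [T minT _] : exists2 T, least_zero G T & (T <= maxn T0 T1)%N.
  apply: least_zero_ex; rewrite /G hT1 ?leq_maxr // strlen_digits yE addKn.
  rewrite (leq_trans hT0) // ltnS; apply: stage_approx_mono; exact: leq_maxl.
have [goodT hpT] : good T /\ (0 < run_within U T (strnum p) y)%N.
  case: minT; rewrite /G strlen_digits yE addKn -/(good T).
  by case: (good T); case: (0 < _)%N.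
have rpT : run_within U T (strnum p) y = x.+1.
  case E: (run_within U T (strnum p) y) hpT => [//|u] _.
  by rewrite (reval_functional (run_withinP E) rp).
have lt_T : (Tq + q' < T)%N.
  rewrite ltnNge; apply/negP => le_T; case/negP: early.
  by apply: leq_trans goodT _; rewrite ltnS; apply: stage_approx_mono.
have rqT : run_within U T q' 0 = x.+1.
  have := run_within_mono U q' 0 (leq_trans (leq_addr q' Tq) (ltnW lt_T)).
  rewrite rTq; case E: (run_within U T q' 0) => [//|u] _.
  by rewrite (reval_functional (run_withinP E) rq).
have := hV2 m c (strnum b) (strnum p) y T minT.
rewrite rpT (min_program_length U_opt rq sq rqT); last by lia.
have -> : (c + 2 ^ m + Cplain U x = Cplain U y)%N by lia.
move=> /hc2; rewrite strlen_utag !strlen_attach !strlen_strnum => hCC.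
have := strlen_log2 R c => hlog.
(* Of the 3 units, 2 pay for replacing twice the length of c by 2 log c, and the last makes the
   contradiction with [le_p] strict. *)
have : (Ccond U (Cplain U y) y + 3 <= size p + 2 * strlen c + 2 ^ m)%N by lia.
rewrite mul2n -addnn -(ler_nat R) !natrD.
by move: le_p; rewrite /bound /CC -/y; lra.
Qed.

Theorem theorem3 (R : realType) (U : recfun 2)
    (U_universal : universal U) (U_optimal : additively_optimal U) :
  exists2 D : nat -> nat -> nat, computable2 D &
    forall alpha beta : R, left_ce alpha -> left_ce beta ->
      (exists d : nat, no_short_transformation U alpha beta d) /\
      (0 <= alpha < 1 -> 0 <= beta < 1 ->
       forall a b : seq bool,
         enumerates_below U a alpha -> enumerates_below U b beta ->
         no_short_transformation U alpha beta (D (size a) (size b))).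
Proof.
(* For reals in [0, 1) the integer part is 0, so a single [K] makes the constant computable from
   |b|. *)
have [K hK] := uniform_no_short_transformation 0 0 U_optimal.
exists (fun _ b => 2 ^ (b + K))%N.
  have : total_rec (fun rho => 2 ^ (rho 1%N + K))%N by do !total_rec_arith.
  by move=> /(_ 2%N)[e he]; exists e => x y; apply: (he [tuple x; y]).
move=> alpha beta _ [f [e he] fbeta]; split; last first.
  by move=> _ beta01 a b _; apply: hK; rewrite subrr subr0.
have [b hb] := U_universal e.
have bbeta : enumerates_below U b beta.
  by exists f => // k; apply/hb; apply: he.
(* For an arbitrary [beta] the machines have its integer part built in, so the constant depends on
   it as well as on |b|. *)
have [z1 [z2 hz]] : exists z1 z2 : nat,
    (Num.floor beta)%:~R = z1%:R - z2%:R :> R.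
  case: (Num.floor beta) => z; first by exists z, 0%N; rewrite subr0.
  by exists 0%N, z.+1; rewrite NegzE rmorphN sub0r.
have [K' hK'] := uniform_no_short_transformation z1 z2 U_optimal.
exists (2 ^ (size b + K'))%N; apply: hK' => //; rewrite -hz.
by have := floor_itv beta; rewrite intrD; lra.
Qed.
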